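(* A partial halved-cube $G$ has connected medians if and only if $G$ is meshed and, whenever $d(u,v)=2$ and $I^{\circ}(u,v)$ consists of two or three pairwise adjacent vertices, $I(u,v)$ is not included in an $\alpha$-configuration or a $\beta$-configuration.
   Context: Graphs are undirected, connected, without loops or multiple edges, and not necessarily finite. $d$ is the standard graph distance of $G=(V,E)$. $\sim$ denotes adjacency, $I(u,v)=\{w: d(u,w)+d(w,v)=d(u,v)\}$, and $I^{\circ}(u,v)=I(u,v)\setminus\{u,v\}$. The halved-cube $\frac12H(X)$ on a set $X$ has as vertices the finite subsets of $X$ of even cardinality, $A,B$ being adjacent iff $|A\triangle B|=2$. A subgraph $H$ of $G'$ is isometric if $d_H=d_{G'}$ on the vertices of $H$. A partial halved-cube is a graph that is (isomorphic to) an isometric subgraph of a halved-cube. $G$ is meshed if for any three vertices $u,v,w$ with $d(v,w)=2$ there is a common neighbor $x$ of $v,w$ with $2d(u,x)\le d(u,v)+d(u,w)$. A profile is a map $\pi:V\to[0,\infty)$ with finite support, $F_\pi(x)=\sum_{u}\pi(u)d(u,x)$, and $\mathrm{Med}(\pi)$ is the set of vertices minimizing $F_\pi$. $G$ has connected medians if $\mathrm{Med}(\pi)$ induces a connected subgraph of $G$ for every profile $\pi$. Let $d(u,v)=2$. $I(u,v)$ is included in a $\beta$-configuration if $I^{\circ}(u,v)=\{s,t,w\}$ consists of three pairwise adjacent vertices and there exist three further vertices $a,b,c$ of $G$ such that $a$ is adjacent to $s$ and to one of $u,v$; $b$ is adjacent to $t$ and to one of $u,v$; $c$ is adjacent to $w$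 and to one of $u,v$; and, apart from possible edges between $a,b,c$, there are no other edges between $\{a,b,c\}$ and $\{u,v,s,t,w\}$ (so the unique neighbor of $a$, $b$, $c$ in $I^{\circ}(u,v)$ is $s$, $t$, $w$, respectively). $I(u,v)$ is included in an $\alpha$-configuration if one of the following holds. Type 1: $I^{\circ}(u,v)$ is $\{s,t\}$ or $\{s,t,w\}$, with pairwise adjacent vertices, and there are a vertex $a$ with $d(a,u)=d(a,v)=d(a,s)=d(a,w)=2$, $d(a,t)=3$, and a vertex $b\notin I(u,v)$ with $b\sim t$, $b\nsim s,w$, and $b$ adjacent to $u$ or to $v$ (conditions involving $w$ are omitted when $I^{\circ}(u,v)=\{s,t\}$). Type 2: $I^{\circ}(u,v)=\{s,t,w\}$ with pairwise adjacent vertices, and there are vertices $a_1,a_2$ with $d(a_1,u)=d(a_1,v)=d(a_1,s)=d(a_1,w)=2$, $d(a_1,t)=3$, $d(a_2,u)=d(a_2,v)=d(a_2,s)=d(a_2,t)=2$, $d(a_2,w)=3$, and a vertex $b\notin I(u,v)$ with $b\sim t,w$, $b\nsim s$, and $b$ adjacent to $u$ or to $v$. Type 3: $I^{\circ}(u,v)=\{s,t,w\}$ with pairwise adjacent vertices, and there are vertices $a_1,a_2,a_3$ with $d(a_1,u)=d(a_1,v)=d(a_1,s)=d(a_1,w)=2$, $d(a_1,t)=3$; $d(a_2,u)=d(a_2,v)=d(a_2,s)=d(a_2,t)=2$, $d(a_2,w)=3$; $d(a_3,u)=d(a_3,v)=d(a_3,t)=d(a_3,w)=2$, $d(a_3,s)=3$.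 *)

(* Defs.v *)
From mathcomp Require Import all_boot all_order all_algebra finmap.
From mathcomp Require Import boolp classical_sets functions cardinality fsbigop.
From mathcomp Require Import reals.

Set Implicit Arguments.
Unset Strict Implicit.
Unset Printing Implicit Defensive.

(* A (possibly infinite) simple graph is a symmetric irreflexive relation
   [e : rel V].  Its vertices form a [choiceType], which is classically no
   restriction and allows finite sets and finitely supported sums. *)

Section Graph.
Local Open Scope classical_set_scope.
Variables (V : choiceType) (e : rel V).
Implicit Types (u v w : V) (A : set V).

Definition walk u v (n : nat) : Prop :=
  exists p : seq V, [/\ path e u p, last u p = v & size p = n].

Definition connected_graph : Prop := forall u v, exists n, walk u v n.

(* The value is 0 when there is no walk from u to v; this never happens in the
   connected graphs to which [dist] is applied. *)
Definition dist u v : nat :=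
  xget 0 [set n | walk u v n /\ forall m, walk u v m -> n <= m].

Definition induced A : rel A := fun x y => e (val x) (val y).

Definition interval u v : set V := [set w | dist u w + dist w v = dist u v].

Definition interior u v : set V := interval u v `\` [set u; v].

Definition meshed : Prop := forall u v w, dist v w = 2 ->
  exists x, [/\ e x v, e x w & 2 * dist u x <= dist u v + dist u w].

(* Since [e] is irreflexive, pairwise adjacent vertices are distinct. *)
Definition interior_clique2 u v s t : Prop :=
  interior u v = [set s; t] /\ e s t.

Definition interior_clique3 u v s t w : Prop :=
  interior u v = [set s; t; w] /\ [/\ e s t, e s w & e t w].

Definition interior_clique23 u v : Prop :=
  (exists s t, interior_clique2 u v s t) \/
  (exists s t w, interior_clique3 u v s t w).

(* The exclusive or [(+)]: a vertex adjacent to one of u, v and with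
   no further edge to {u, v} is adjacent to exactly one of them. *)
Definition in_beta_configuration u v : Prop :=
  exists s t w a b c,
    [/\ interior_clique3 u v s t w,
        uniq [:: u; v; s; t; w; a; b; c],
        [&& e a s, e a u (+) e a v, ~~ e a t & ~~ e a w],
        [&& e b t, e b u (+) e b v, ~~ e b s & ~~ e b w] &
        [&& e c w, e c u (+) e c v, ~~ e c s & ~~ e c t]].

Definition alpha_type1 u v : Prop :=
  (exists s t, interior_clique2 u v s t /\ exists a b,
    [/\ [/\ dist a u = 2, dist a v = 2, dist a s = 2 & dist a t = 3],
        ~ interval u v b &
        [&& e b t, ~~ e b s & e b u || e b v]])
  \/
  (exists s t w, interior_clique3 u v s t w /\ exists a b,
    [/\ [/\ dist a u = 2, dist a v = 2, dist a s = 2, dist a w = 2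
          & dist a t = 3],
        ~ interval u v b &
        [&& e b t, ~~ e b s, ~~ e b w & e b u || e b v]]).

Definition alpha_type2 u v : Prop :=
  exists s t w, interior_clique3 u v s t w /\ exists a1 a2 b,
    [/\ [/\ dist a1 u = 2, dist a1 v = 2, dist a1 s = 2, dist a1 w = 2
          & dist a1 t = 3],
        [/\ dist a2 u = 2, dist a2 v = 2, dist a2 s = 2, dist a2 t = 2
          & dist a2 w = 3],
        ~ interval u v b &
        [&& e b t, e b w, ~~ e b s & e b u || e b v]].

Definition alpha_type3 u v : Prop :=
  exists s t w, interior_clique3 u v s t w /\ exists a1 a2 a3,
    [/\ [/\ dist a1 u = 2, dist a1 v = 2, dist a1 s = 2, dist a1 w = 2
          & dist a1 t = 3],
        [/\ dist a2 u = 2, dist a2 v = 2, dist a2 s = 2, dist a2 t = 2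
          & dist a2 w = 3] &
        [/\ dist a3 u = 2, dist a3 v = 2, dist a3 t = 2, dist a3 w = 2
          & dist a3 s = 3]].

Definition in_alpha_configuration u v : Prop :=
  [\/ alpha_type1 u v, alpha_type2 u v | alpha_type3 u v].

End Graph.

Section Medians.
Local Open Scope classical_set_scope.
Local Open Scope ring_scope.
Variables (R : realType) (V : choiceType) (e : rel V).

Definition is_profile (pi : V -> R) : Prop :=
  (forall u, 0 <= pi u) /\ finite_set [set u | pi u != 0].

(* The sum is over the finitely many u with a nonzero term. *)
Definition median_fun (pi : V -> R) (x : V) : R :=
  \sum_(u \in [set: V]) (pi u * (dist e u x)%:R).

Definition median_set (pi : V -> R) : set V :=
  [set x | forall y, median_fun pi x <= median_fun pi y].

Definition connected_medians : Prop :=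
  forall pi, is_profile pi -> connected_graph (induced e (A := median_set pi)).

End Medians.

Section HalvedCube.
Local Open Scope fset_scope.

Definition even_fset (X : choiceType) : choiceType :=
  {A : {fset X} | ~~ odd #|` A|}.

Definition symdiff (X : choiceType) (A B : {fset X}) : {fset X} :=
  (A `\` B) `|` (B `\` A).

Definition halved_cube (X : choiceType) : rel (even_fset X) :=
  fun A B => #|` symdiff (val A) (val B)| == 2.

(* [f] is an isomorphism onto the subgraph with the images of the vertices and
   edges of [e]; distances in this subgraph are those of [e]. *)
Definition isometric_embedding (V W : choiceType) (e : rel V) (e' : rel W)
    (f : V -> W) : Prop :=
  [/\ injective f, {homo f : u v / e u v >-> e' u v} &
      forall u v, dist e' (f u) (f v) = dist e u v].

Definition partial_halved_cube (V : choiceType) (e : rel V) : Prop :=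
  exists (X : choiceType) (f : V -> even_fset X),
    isometric_embedding e (@halved_cube X) f.

End HalvedCube.

(* Main.v *)
Require Import Defs.
From mathcomp Require Import all_boot all_order all_algebra.
From mathcomp Require Import reals.
From mathcomp Require Import finmap boolp classical_sets functions cardinality.
From mathcomp Require Import fsbigop zify lra.

(** Let d(u,v) = 2.  If some finite multiset of vertices has, at every common
    neighbour of u and v, a distance sum larger than the mean of its distance
    sums at u and at v, then adding suitably many copies of u and v turns it
    into a profile for which u and v are medians while no neighbour of u is one
    ([connected_medians_interior]).  With a single vertex as multiset this
    yields meshedness, and the vertices a, b, c of the alpha- and
    beta-configurations form such multisets ([connected_medians_no_alpha],
    [connected_medians_no_beta]).

    Conversely, it is enough to find, whenever d(u,v) = 2, a few common
    neighbours of u and v which are [balanced]: their mean distance to any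
    vertex y is at most the mean distance of u and v to y.  Summing over a
    profile, every median function F then satisfies 2 F(s) <= F(u) + F(v) for
    some common neighbour s.  This weak convexity at distance 2 propagates to
    all distances ([median_fun_convex]), so that two medians are joined by a
    shortest path of medians ([balanced_connected_medians]).

    In a halved cube the common neighbours of u and v form an octahedron.  In
    the subgraph some of its six vertices are present.  Two opposite ones, s
    and t, are balanced, as d(y,s) + d(y,t) = d(y,u) + d(y,v) for all y.
    Otherwise one, two or three pairwise adjacent vertices are present.  Call
    2 d(y,s) - d(y,u) - d(y,v) the excess of y at s; it lies between -2 and 2,
    its parity does not depend on s, and an excess of 2 at s forces an excess
    of 0 at the other vertices ([interior_far]).  Meshedness says that no y has
    positive excess everywhere; in particular a single common neighbour is
    balanced.  For a triangle s, t, w, say that s is far if some y has excess 2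
    at s.  If two vertices s and w are not far, they can only fail to be
    balanced through a vertex with excesses -1 at t and 1 at s and w; if t is
    far, this gives a configuration of type 1, and if no vertex is far, failure
    of all three pairs gives a beta-configuration.  If t and w are far, s alone
    can only fail to be balanced if s is far as well (type 3) or through a
    vertex with excess 1 at s and -1 at t or w (type 1 or 2).  Two adjacent
    common neighbours behave similarly and only lead to type 1.

    The vertices of these configurations have to be found next to I(u,v),
    whereas the excesses are attained anywhere.  A meshed graph satisfies the
    triangle condition ([triangle_condition]), which moves vertices of given
    excesses close to I(u,v): an excess of 2 at t gives a vertex a with
    distance 3 to t and distance 2 to the others ([far_vertex]), and an excess
    of -1 at t, and 1 at some other vertex, gives a neighbour b of t
    and of exactly one of u, v ([pendant_exists]). *)

Set Implicit Arguments.
Unset Strict Implicit.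
Unset Printing Implicit Defensive.

(** * Walks *)

Section Walk.
Local Open Scope nat_scope.
Variables (V : choiceType) (e : rel V).
Implicit Types (u v w : V) (n : nat).

Lemma walk0 u : walk e u u 0.
Proof. by exists [::]. Qed.

Lemma walk_cons u v w n : e u v -> walk e v w n -> walk e u w n.+1.
Proof.
move=> uv [p [ep lp sp]]; exists (v :: p); split=> //=; first by rewrite uv.
by rewrite sp.
Qed.

Lemma walkS u w n : walk e u w n.+1 -> exists2 v, e u v & walk e v w n.
Proof.
case=> -[|v p] [//= /andP[uv ep] lp [sp]].
by exists v => //; exists p.
Qed.

Lemma walk_cat u v w n m : walk e u v n -> walk e v w m -> walk e u w (n + m).
Proof.
move=> [p [ep lp sp]] [q [eq lq sq]]; exists (p ++ q).
by rewrite cat_path last_cat size_cat lp ep eq lq sp sq.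
Qed.

Lemma dist_spec u v n : walk e u v n ->
  walk e u v (dist e u v) /\ forall m, walk e u v m -> dist e u v <= m.
Proof.
move=> wn; have exP : exists k, `[< walk e u v k >] by exists n; apply/asboolP.
rewrite /dist; case: xgetP => [d _ [wd min_d] //|none].
have [k /asboolP wk min_k] := ex_minnP exP.
by have [] := none k; split=> // m wm; apply/min_k/asboolP.
Qed.

End Walk.

(** * Distances in halved cubes *)

Section HalvedCubeDistance.
Local Open Scope fset_scope.
Local Open Scope nat_scope.
Variable X : choiceType.
Implicit Types (A B C U W : {fset X}).

Lemma in_symdiff A B i : (i \in symdiff A B) = (i \in A) (+) (i \in B).
Proof. by rewrite !inE; case: (i \in A); case: (i \in B). Qed.

Lemma card_symdiff A B : #|` symdiff A B| = #|` A `\` B| + #|` B `\` A|.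
Proof.
rewrite -cardfsUI [X in _ + #|` X|](_ : _ = fset0) ?cardfs0 ?addn0 //.
by apply/fsetP => i; rewrite !inE; case: (i \in A); rewrite ?andbF.
Qed.

Lemma odd_symdiff A B : odd #|` symdiff A B| = odd #|` A| (+) odd #|` B|.
Proof.
rewrite card_symdiff -(cardfsID B A) -(cardfsID A B) fsetIC !oddD.
by case: odd; case: odd; case: odd.
Qed.

Lemma symdiff_triangle A B C :
  #|` symdiff A C| <= #|` symdiff A B| + #|` symdiff B C|.
Proof.
rewrite -cardfsUI (leq_trans _ (leq_addr _ _)) // fsubset_leq_card //.
apply/fsubsetP => i; rewrite in_fsetU !in_symdiff.
by case: (i \in A); case: (i \in B); case: (i \in C).
Qed.

Lemma halved_walk_le (A B : even_fset X) n : walk (@halved_cube X) A B n ->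
  #|` symdiff (val A) (val B)| <= 2 * n.
Proof.
elim: n A => [|n IHn] A.
  case=> -[|? ?] [] //= _ -> _; rewrite leqn0 cardfs_eq0.
  by apply/eqP/fsetP => i; rewrite in_symdiff addbb inE.
move=> /walkS[C /eqP adjAC /IHn]; rewrite mulnS -adjAC => le.
exact: leq_trans (symdiff_triangle _ _ _) (leq_add _ le).
Qed.

(** Each step settles two elements of the symmetric difference, which keeps the
    cardinality even. *)
Lemma halved_walk (A B : even_fset X) n :
  #|` symdiff (val A) (val B)| = 2 * n -> walk (@halved_cube X) A B n.
Proof.
elim: n A => [|n IHn] A AB.
  suff -> : A = B by exact: walk0.
  apply: val_inj; apply/fsetP => i; move/eqP: AB; rewrite muln0 cardfs_eq0.
  move=> /eqP/fsetP/(_ i); rewrite in_symdiff inE.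
  by case: (i \in val A); case: (i \in val B).
have [i iD] : exists i, i \in symdiff (val A) (val B).
  by apply/fset0Pn; rewrite -cardfs_eq0 AB mulnS.
have [j jD] : exists j, j \in symdiff (val A) (val B) `\ i.
  by apply/fset0Pn; rewrite -cardfs_eq0; move: AB; rewrite (cardfsD1 i) iD; lia.
have ij : i != j by move: jD; rewrite !inE eq_sym => /andP[].
pose P := [fset i; j]; have cardP : #|` P| = 2 by rewrite cardfs2 ij.
have evenC : ~~ odd #|` symdiff (val A) P|.
  by rewrite odd_symdiff cardP addbF; exact: (valP A).
pose C : even_fset X := Sub (symdiff (val A) P) evenC.
apply: (@walk_cons _ _ _ C).
  rewrite /halved_cube -cardP; apply/eqP; congr #|` _|.
  by apply/fsetP => k; rewrite !in_symdiff addKb.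
apply: IHn.
have -> : symdiff (val C) (val B) = (symdiff (val A) (val B)) `\` P.
  apply/fsetP => k; rewrite in_symdiff SubK in_symdiff in_fsetD in_symdiff.
  have : (k \in P) ==> (k \in symdiff (val A) (val B)).
    apply/implyP; rewrite !inE => /orP[]/eqP->; first by move: iD; rewrite !inE.
    by move: jD; rewrite !inE => /andP[_].
  rewrite in_symdiff.
  by case: (k \in P); case: (k \in val A); case: (k \in val B).
rewrite cardfsDS ?AB ?cardP ?mulnS ?addKn //.
apply/fsubsetP => k; rewrite in_fset2 => /orP[]/eqP-> //.
by move: jD; rewrite in_fsetD => /andP[].
Qed.

Lemma dist_halved_cube (A B : even_fset X) :
  2 * dist (@halved_cube X) A B = #|` symdiff (val A) (val B)|.
Proof.
have D2 : #|` symdiff (val A) (val B)| = 2 * #|` symdiff (val A) (val B)|./2.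
  have := odd_double_half #|` symdiff (val A) (val B)|.
  rewrite odd_symdiff (negPf (valP A)) (negPf (valP B)) -mul2n; lia.
have [wd d_min] := dist_spec (halved_walk D2).
by apply/eqP; rewrite eqn_leq halved_walk_le // D2 leq_mul2l /= d_min //; exact: halved_walk.
Qed.

Definition hamming (p q : seq bool) : nat :=
  count (fun x => x.1 (+) x.2) (zip p q).

Lemma hamming_map (f g : X -> bool) (r : seq X) :
  hamming (map f r) (map g r) = count (fun i => f i (+) g i) r.
Proof. by elim: r => //= i r <-. Qed.

(** The coordinates in W, with U as origin. *)
Definition coordinates U W A : seq bool :=
  [seq (i \in A) (+) (i \in U) | i <- W].

Lemma card_fsetI_count A W : #|` A `&` W| = count (mem A) W.
Proof.
rewrite -size_filter; apply/perm_size/uniq_perm => //.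
  exact/filter_uniq/fset_uniq.
by move=> i; rewrite mem_filter inE.
Qed.

Lemma card_symdiff_hamming U W A B : #|` symdiff A B| =
  hamming (coordinates U W A) (coordinates U W B) + #|` symdiff A B `\` W|.
Proof.
rewrite -(cardfsID W) hamming_map card_fsetI_count; congr (_ + _).
apply: eq_count => i; rewrite /= in_symdiff.
by case: (i \in A); case: (i \in B); case: (i \in U).
Qed.

End HalvedCubeDistance.

(** * The octahedron of weight-two words *)

Section Octahedron.
Local Open Scope nat_scope.

Fixpoint bitseqs n : seq (seq bool) :=
  if n is m.+1 then map (cons false) (bitseqs m) ++ map (cons true) (bitseqs m)
  else [:: [::]].

Lemma mem_bitseqs p : p \in bitseqs (size p).
Proof.
elim: p => [//|b p IHp] /=; rewrite mem_cat.
by case: b; rewrite map_f ?orbT.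
Qed.

(** With u as origin and the four elements in which u and v differ as
    coordinates, v is the antipode and the common neighbours of u and v are
    words of weight two; these are the vertices of an octahedron in which
    opposite vertices have Hamming distance 4 and adjacent ones 2.  For z in
    I(u,v), 2 d(y,z) is a Hamming distance up to a term depending only on y, so
    that facts about the excess 2 d(y,s) - d(y,u) - d(y,v) are checked by
    enumerating words: the excess is the Hamming distance of y and s minus 2. *)
Definition origin := nseq 4 false.
Definition antipode := nseq 4 true.
Definition middle : seq (seq bool) :=
  [seq p <- bitseqs 4 | (hamming p origin == 2) && (hamming p antipode == 2)].

Lemma hamming_ends p : p \in bitseqs 4 ->
  hamming p origin + hamming p antipode = 4.
Proof.
have /allP chk : all (fun p => hamming p origin + hamming p antipode == 4)
  (bitseqs 4) by vm_compute.
by move=> /chk /eqP.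
Qed.

Lemma middle_opposite p q y : p \in middle -> q \in middle ->
    y \in bitseqs 4 -> hamming p q = 4 ->
  hamming y p + hamming y q = 4.
Proof.
have /allP chk : all (fun p => all (fun q => all (fun y =>
    (hamming p q == 4) ==> (hamming y p + hamming y q == 4))
  (bitseqs 4)) middle) middle by vm_compute.
move=> /chk /allP chk1 /chk1 /allP chk2 /chk2 /implyP chk3 /eqP /chk3 /eqP //.
Qed.

Lemma middle_far p q y : p \in middle -> q \in middle -> y \in bitseqs 4 ->
  hamming p q = 2 -> hamming y p = 4 -> hamming y q = 2.
Proof.
have /allP chk : all (fun p => all (fun q => all (fun y =>
    (hamming p q == 2) && (hamming y p == 4) ==> (hamming y q == 2))
  (bitseqs 4)) middle) middle by vm_compute.
move=> /chk /allP chk1 /chk1 /allP chk2 /chk2 /implyP chk3 /eqP pq /eqP yp.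
by apply/eqP/chk3/andP.
Qed.

Lemma middle_K4 p q r s :
    p \in middle -> q \in middle -> r \in middle -> s \in middle ->
  [&& hamming p q == 2, hamming p r == 2, hamming p s == 2, hamming q r == 2,
      hamming q s == 2 & hamming r s == 2] = false.
Proof.
have /allP chk : all (fun p => all (fun q => all (fun r => all (fun s =>
  ~~ [&& hamming p q == 2, hamming p r == 2, hamming p s == 2, hamming q r == 2,
      hamming q s == 2 & hamming r s == 2]) middle) middle) middle) middle
  by vm_compute.
move=> /chk /allP chk1 /chk1 /allP chk2 /chk2 /allP chk3 /chk3 chk4.
exact: negPf.
Qed.

(** On a triangle of the octahedron the three excesses of an odd word y are 1 or
    -1, and the product of the three signs depends only on whether y is nearer
    to the origin or to the antipode.  Hence if the signs for y multiply to 1,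
    two signs for z determine the third. *)
Lemma middle_side p q r y z :
    p \in middle -> q \in middle -> r \in middle ->
    y \in bitseqs 4 -> z \in bitseqs 4 ->
    hamming p q = 2 -> hamming p r = 2 -> hamming q r = 2 ->
    (hamming y origin < hamming y antipode) =
      (hamming z origin < hamming z antipode) ->
    [&& 2 < hamming y p, hamming y q < 2 & hamming y r < 2] ->
  2 < hamming z p -> hamming z q < 2 -> hamming z r < 2.
Proof.
have /allP chk : all (fun p => all (fun q => all (fun r =>
    [&& hamming p q == 2, hamming p r == 2 & hamming q r == 2] ==>
    all (fun y => all (fun z =>
      [&& (hamming y origin < hamming y antipode) ==
          (hamming z origin < hamming z antipode),
         [&& 2 < hamming y p, hamming y q < 2 & hamming y r < 2],
         2 < hamming z p & hamming z q < 2] ==> (hamming z r < 2))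
  (bitseqs 4)) (bitseqs 4)) middle) middle) middle by vm_compute.
move=> /chk /allP chk1 /chk1 /allP chk2 /chk2 /implyP chk3 yb zb pq pr qr.
have /allP/(_ y yb)/allP/(_ z zb)/implyP chk4 := chk3 ltac:(by rewrite pq pr qr).
by move=> side yP zp zq; apply: chk4; rewrite side eqxx yP zp zq.
Qed.

End Octahedron.

(** * Distances in connected graphs *)

Section Distance.
Local Open Scope nat_scope.
Variables (V : choiceType) (e : rel V).
Implicit Types (u v w x y s t : V) (n k : nat).
Hypothesis e_sym : symmetric e.
Hypothesis e_irr : irreflexive e.
Hypothesis e_conn : connected_graph e.
Local Notation d := (dist e).

Lemma walk_dist u v : walk e u v (d u v).
Proof. by have [n /dist_spec[]] := e_conn u v. Qed.

Lemma dist_le_walk u v n : walk e u v n -> d u v <= n.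
Proof. by move=> wn; have [_ ->] := dist_spec wn. Qed.

Lemma dist_triangle u v w : d u w <= d u v + d v w.
Proof. exact: dist_le_walk (walk_cat (walk_dist u v) (walk_dist v w)). Qed.

Lemma distxx u : d u u = 0.
Proof. by apply/eqP; rewrite -leqn0; exact: dist_le_walk (walk0 e u). Qed.

Lemma dist0 u v : d u v = 0 -> u = v.
Proof. by move=> d0; have := walk_dist u v; rewrite d0 => -[[|? ?] []]. Qed.

Lemma walk_sym u v n : walk e u v n -> walk e v u n.
Proof.
elim: n u => [|n IHn] u; first by case=> -[|? ?] [] //= _ -> _; exact: walk0.
move=> /walkS[w uw /IHn wn]; rewrite -addn1; apply: walk_cat wn _.
by rewrite e_sym in uw; apply: walk_cons uw _; exact: walk0.
Qed.

Lemma dist_sym u v : d u v = d v u.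
Proof.
by apply/eqP; rewrite eqn_leq !dist_le_walk //; exact: walk_sym (walk_dist _ _).
Qed.

Lemma dist_pos u v : u <> v -> 0 < d u v.
Proof. by rewrite lt0n; apply: contra_not_neq => /dist0. Qed.

Lemma dist_adj u v : e u v -> d u v = 1.
Proof.
move=> uv; apply/eqP; rewrite eqn_leq dist_pos ?andbT.
  exact: dist_le_walk (walk_cons uv (walk0 e v)).
by move=> eq_uv; rewrite eq_uv e_irr in uv.
Qed.

Lemma adj_dist u v : d u v = 1 -> e u v.
Proof.
move=> d1; have := walk_dist u v; rewrite d1 => /walkS[w uw].
by case=> -[|? ?] [] //= _ <-.
Qed.

Lemma dist_ge2 u v : u <> v -> ~~ e u v -> 2 <= d u v.
Proof.
move=> /dist_pos uv; apply: contraNT; rewrite -ltnNge => lt2.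
by apply: adj_dist; lia.
Qed.

Lemma dist_step u v k : d u v = k.+1 -> exists2 w, e u w & d w v = k.
Proof.
move=> duv; have := walk_dist u v; rewrite duv => /walkS[w uw wn]; exists w => //.
have := dist_triangle u w v; have := dist_le_walk wn.
rewrite duv (dist_adj uw); lia.
Qed.

Lemma dist_adj_le x u v : e u v -> d x u <= (d x v).+1.
Proof.
by move=> uv; have := dist_triangle x v u; rewrite (dist_sym v u) (dist_adj uv) addn1.
Qed.

Lemma interiorE u v : d u v = 2 ->
  forall s, interior e u v s <-> e s u /\ e s v.
Proof.
move=> duv s; split=> [[dsum /not_orP[su sv]]|[su sv]].
  rewrite /Defs.interval /= duv in dsum.
  have := dist_pos su; have := dist_pos sv; rewrite (dist_sym s u).
  by move=> ? ?; split; apply: adj_dist; rewrite ?(dist_sym s u); lia.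
rewrite /interior /Defs.interval /= (dist_sym u s) (dist_adj su) (dist_adj sv) duv.
split=> // -[] es.
  by rewrite es e_irr in su.
by rewrite es e_irr in sv.
Qed.

Lemma interior_sym u v : d u v = 2 ->
  forall s, interior e u v s <-> interior e v u s.
Proof. by move=> duv s; rewrite !interiorE // 1?dist_sym //; tauto. Qed.

(** * Meshed graphs *)

Section Meshed.
Hypothesis e_mesh : meshed e.

(** The inductive step takes y at distance k from both v and w, closer to x;
    meshedness for v, y seen from w yields a neighbour of v one step closer to
    x that is not w, hence is adjacent to w as well. *)
Lemma triangle_condition x v w k : e v w -> d x v = k.+1 -> d x w = k.+1 ->
  exists y, [/\ e y v, e y w & d x y = k].
Proof.
elim: k v w => [|k IHk] v w vw dv dw.
  by exists x; rewrite distxx; split=> //; exact: adj_dist.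
have dv' : d v x = k.+2 by rewrite dist_sym.
have [v' vv' dv'x] := dist_step dv'; rewrite dist_sym in dv'x.
have [v'w|v'Nw] := boolP (e v' w).
  by exists v'; rewrite e_sym.
have dv'w : d v' w = 2.
  apply/eqP; rewrite eqn_leq dist_ge2 // ?andbT.
    by have := dist_adj_le v' vw; have := dist_adj_le v' (etrans (e_sym w v) vw);
      rewrite (dist_sym v' v) (dist_adj vv').
  by move=> E; rewrite -E dv'x in dw; lia.
have [w' [w'v' w'w]] := e_mesh x dv'w; rewrite dv'x dw => dw'.
have dxw' : d x w' = k.+1.
  have := dist_adj_le x (etrans (e_sym w w') w'w); move: dw dw'; clear; lia.
have v'w' : e v' w' by rewrite e_sym.
have [y [yv' yw' dy]] := IHk _ _ v'w' dv'x dxw'.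
have dvy : d v y = 2.
  have := dist_adj_le v yv'; rewrite (dist_adj vv') => dvy.
  have := dist_triangle x y v; rewrite (dist_sym y v).
  by move: dv dy dvy; clear; lia.
have [z [zv zy]] := e_mesh w dvy.
have : d w y <= 2 by have := dist_adj_le w yw'; rewrite (dist_sym w w') (dist_adj w'w).
rewrite (dist_adj (etrans (e_sym w v) vw)) => dwy dwz.
have dxz : d x z <= k.+1.
  by have := dist_adj_le x zy; move: dy; clear; lia.
exists z; split=> //; last first.
  have := dist_adj_le x (etrans (e_sym v z) zv).
  by move: dv dxz; clear; lia.
apply: adj_dist; have := dist_pos (u := z) (v := w); rewrite dist_sym.
have zw : z <> w by move=> E; rewrite E dw ltnn in dxz.
by move=> /(_ zw); move: dwy dwz; clear; lia.
Qed.

(** From x, the triangle condition for v, s gives p; meshedness for u, p gives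
    c, which is also one step closer to x than u is; the triangle condition for
    c, p gives a, two steps closer to x than u is.  As c and p are adjacent to
    a, the vertices u, v and s have distance 2 to a.  The last hypothesis
    prevents p from being adjacent to u and thus from lying between u and v. *)
Lemma far_vertex u v s t x k : d u v = 2 ->
    interior e u v s -> interior e u v t ->
    d x u = k -> d x v = k -> d x s = k -> d x t = k.+1 ->
    (forall p, interior e u v p -> k <= d x p) ->
  exists a, [/\ d a u = 2, d a v = 2, d a s = 2 & d a t = 3].
Proof.
move=> duv /(interiorE duv)[su sv] /(interiorE duv)[tu tv] xu xv xs xt min_k.
case: k => [|[|k]] in xu xv xs xt min_k.
- by rewrite -(dist0 xu) -(dist0 xv) distxx in duv.
- have /min_k : interior e u v x by apply/(interiorE duv); split; exact: adj_dist.
  by rewrite distxx.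
have vs : e v s by rewrite e_sym.
have [p [pv ps xp]] := triangle_condition vs xv xs.
have far y : d x y = k.+1 -> d u v = 2 -> e y v -> ~~ e u y.
  move=> xy _ yv; apply/negP => uy.
  have /min_k : interior e u v y by apply/(interiorE duv); rewrite e_sym.
  by rewrite xy ltnn.
have uNp := far _ xp duv pv.
have dup : d u p = 2.
  apply/eqP; rewrite eqn_leq dist_ge2 // ?andbT.
    by have := dist_adj_le u ps; rewrite (dist_sym u s) (dist_adj su).
  by move=> E; rewrite E in xu; lia.
have [c [cu cp]] := e_mesh x dup; rewrite xu xp => xc_le.
have xc : d x c = k.+1.
  have := dist_adj_le x (etrans (e_sym u c) cu).
  by move: xu xc_le; clear; lia.
have [a [ac ap xa]] := triangle_condition cp xc xp.
exists a.
have up y z : e a y -> e y z -> d x z = k.+2 -> d a z = 2.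
  move=> ay yz xz; have := dist_triangle x a z.
  have := dist_adj_le a (etrans (e_sym z y) yz); rewrite (dist_adj ay).
  by move: xa xz; clear; lia.
have au := up _ _ ac cu xu; have av := up _ _ ap pv xv.
split=> //; first exact: up ap ps xs.
have := dist_triangle x a t; have := dist_adj_le a tu.
by move: xa xt au; clear; lia.
Qed.

(** A neighbour b of p one step closer to y cannot be adjacent to a vertex that
    is further from y than p. *)
Lemma near_vertex y p s k : e p s -> d y p = k.+1 -> d y s = k.+1 ->
  exists b, [/\ e b p, e b s & forall z, k.+1 < d y z -> ~~ e b z].
Proof.
move=> ps yp ys; have [b [bp bs yb]] := triangle_condition ps yp ys.
exists b; split=> // z; apply: contraTN => bz.
by have := dist_adj_le y (etrans (e_sym z b) bz); lia.
Qed.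

End Meshed.


(** * Connected medians as a condition on vertices at distance 2 *)

Section MedianFunctions.
Variable R : realType.
Local Open Scope ring_scope.
Import Order.TTheory GRing.Theory Num.Theory.
Implicit Type pi : V -> R.

Lemma is_profile_count (M : seq V) :
  is_profile (fun y => (count_mem y M)%:R : R).
Proof.
split=> [y|]; first exact: ler0n.
apply: sub_finite_set (finite_seq M) => y /=; rewrite pnatr_eq0.
by rewrite -lt0n -has_count has_pred1.
Qed.

Lemma median_fun_count (M : seq V) x :
  median_fun e (fun y => (count_mem y M)%:R : R) x =
  (\sum_(a <- M) d a x)%N%:R.
Proof.
rewrite /median_fun (@fsbigTE _ _ _ _ [fset a in M]%fset); last first.
  move=> y; rewrite inE => /count_memPn ->; by rewrite mul0r.
set A := [fset a in M]%fset.
have : {subset M <= A} by move=> y; rewrite inE.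
elim: M A => [|a M IHM] A sMA.
  by rewrite big_nil big1 // => i _; rewrite mul0r.
rewrite big_cons natrD -(IHM A); last by move=> y yM; rewrite sMA // inE yM orbT.
under eq_bigr => i _ do rewrite /= natrD mulrDl.
rewrite big_split /=; congr (_ + _).
have aA : a \in A by rewrite sMA // inE eqxx.
rewrite (big_fsetD1 a) //= eqxx mul1r big1_fset ?addr0 // => i.
by rewrite !inE eq_sym => /andP[/negPf-> _] _; rewrite mul0r.
Qed.

(** Suppose that at every s strictly between u and v the distance sum of L
    exceeds the mean of its values at u and v.  Doubling L and adding copies of
    v equalises the sums at u and v and keeps them smaller than those at the s.
    Then adding many copies of both u and v penalises all vertices outside
    I(u,v), so that u is a median isolated from the median v. *)
Lemma connected_medians_interior u v (L : seq V) : connected_medians R e ->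
    d u v = 2 ->
  exists2 s, interior e u v s &
    (2 * \sum_(a <- L) d a s <= \sum_(a <- L) (d a u + d a v))%N.
Proof.
move=> e_med; wlog le_uv : u v / (\sum_(a <- L) d a u <= \sum_(a <- L) d a v)%N.
  move=> IH duv; have [/IH|/ltnW/IH] := leqP (\sum_(a <- L) d a u) (\sum_(a <- L) d a v).
    exact.
  case; first by rewrite dist_sym.
  move=> s /interior_sym s_int s_le; exists s; first by apply: s_int; rewrite dist_sym.
  by rewrite big_split /= addnC -big_split.
move=> duv; apply: contrapT => none.
set G := fun x => (\sum_(a <- L) d a x)%N.
have G_gt s : interior e u v s -> (G u + G v < 2 * G s)%N.
  move=> s_int; rewrite ltnNge; apply/negP => s_le; apply: none; exists s => //.
  by rewrite big_split /=.
(* [2 * G v < N] makes the penalty outside I(u,v), where the distances to u and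
   v sum to at least 3, outweigh the rest of [F v]. *)
have [N N_gt] : exists N, (2 * G v < N)%N by exists (2 * G v).+1.
pose M := L ++ L ++ nseq (G v - G u) v ++ nseq N u ++ nseq N v.
pose F x := (2 * G x + (G v - G u) * d v x + N * (d u x + d v x))%N.
have FE x : median_fun e (fun y => (count_mem y M)%:R : R) x = (F x)%:R.
  rewrite median_fun_count !big_cat /= !big_nseq !iter_addn_0; congr (_%:R).
  rewrite -/(G x) /F.
  generalize (G x) (G v - G u)%N N (d u x) (d v x); clear; lia.
have Fu : F u = F v.
  by move: le_uv; rewrite -/(G u) -/(G v) /F !distxx (dist_sym v u) duv; lia.
have Fv : F v = (2 * G v + N * 2)%N by rewrite /F !distxx duv; lia.
have F_gt x : ~ interior e u v x -> x <> u -> x <> v -> (F v < F x)%N.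
  move=> xI xu xv; have : (3 <= d u x + d v x)%N.
    rewrite ltnNge; apply/negP => le2; apply: xI; split; last by case.
    have := dist_triangle u x v; rewrite /Defs.interval /= (dist_sym x v) duv; lia.
  by rewrite Fv /F; nia.
have F_gtI x : interior e u v x -> (F v < F x)%N.
  move=> xI; have [xu xv] := (interiorE duv x).1 xI.
  rewrite Fv /F (dist_sym u) (dist_sym v) (dist_adj xu) (dist_adj xv).
  by have := G_gt x xI; move: le_uv; rewrite -/(G u) -/(G v); lia.
have F_min x : (F v <= F x)%N.
  have [->|/eqP xu] := eqVneq x u; first by rewrite Fu.
  have [->//|/eqP xv] := eqVneq x v.
  by have [/F_gtI/ltnW//|xI] := pselect (interior e u v x); exact/ltnW/F_gt.
set pi := fun y => (count_mem y M)%:R : R.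
have med x : median_set e pi x <-> F x = F v.
  split=> [/(_ v)|Fx y]; last by rewrite !FE ler_nat Fx F_min.
  by rewrite !FE ler_nat => le; apply/eqP; rewrite eqn_leq le F_min.
have [n] := e_med pi (is_profile_count M) (exist _ u (mem_set ((med u).2 Fu)))
              (exist _ v (mem_set ((med v).2 erefl))).
case: n => [|n].
  by case=> -[|? ?] [] //= _ [] E; rewrite E distxx in duv.
case=> -[|[x x_med] p] [] //= /andP[ux _] _ _.
rewrite /induced /= in ux.
have Fx := (med x).1 (set_mem x_med).
have xu : x <> u by move=> E; rewrite E e_irr in ux.
have xv : x <> v by move=> E; rewrite -E (dist_adj ux) in duv.
by have [/F_gtI|/F_gt/(_ xu xv)] := pselect (interior e u v x); rewrite Fx ltnn.
Qed.

Lemma median_fun_seq pi : is_profile pi ->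
  exists r : seq V, forall x,
    median_fun e pi x = \sum_(i <- r) pi i * (d i x)%:R.
Proof.
move=> [_ fin]; exists (fset_set [set y | pi y != 0]) => x.
rewrite /median_fun (@fsbigTE _ _ _ _ (fset_set [set y | pi y != 0])) // => i.
by rewrite in_fset_set // mem_setE negbK => /eqP ->; rewrite mul0r.
Qed.

(** The average over S is multiplied by 2 and by the length of S, to stay within
    natural numbers. *)
Definition balanced u v (S : seq V) : Prop :=
  [/\ S <> [::], forall s, s \in S -> interior e u v s &
      forall y, 2 * \sum_(s <- S) d y s <= size S * (d y u + d y v)]%N.

Lemma balanced_median_fun u v S pi : balanced u v S -> is_profile pi ->
  exists2 s, interior e u v s &
    2 * median_fun e pi s <= median_fun e pi u + median_fun e pi v.
Proof.
move=> [S0 S_int S_le] pi_prof; have [r FE] := median_fun_seq pi_prof.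
set F := median_fun e pi in FE *; apply: contrapT => none.
have lt s : s \in S -> F u + F v < 2 * F s.
  move=> sS; rewrite ltNge; apply/negP => s_le; apply: none; exists s => //.
  exact: S_int.
have : \sum_(s <- S) (F u + F v) < \sum_(s <- S) 2 * F s.
  case: S S0 lt {S_int S_le} => // s S _ lt.
  rewrite !big_cons ltr_leD ?lt ?mem_head // !big_seq ler_sum // => t tS.
  by apply/ltW/lt; rewrite inE tS orbT.
apply/negP; rewrite -leNgt big_const_seq count_predT iter_addr_0 -mulr_sumr.
under eq_bigr do rewrite FE.
rewrite exchange_big /= !FE -big_split /= -[leRHS]mulr_natr mulr_suml mulr_sumr.
apply: ler_sum => i _; rewrite -mulr_sumr -mulrDr mulrCA -mulrA.
apply: ler_wpM2l; first exact: pi_prof.1.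
by rewrite -natr_sum -natrD -!natrM ler_nat mulnC [leqRHS]mulnC; have := S_le i; lia.
Qed.

Lemma finite_weighted_sums (r : seq V) pi (b : V -> nat) :
  finite_set [set \sum_(i <- r) pi i * (n i)%:R |
              n in [set n : V -> nat | forall i, (n i <= b i)%N]].
Proof.
elim: r => [|i r IHr].
  apply: sub_finite_set (finite_set1 (0 : R)) => _ [n _ <-].
  by rewrite big_nil.
have fin_i : finite_set [set pi i * k%:R | k in `I_(b i).+1].
  exact/finite_image/finite_II.
apply: sub_finite_set (finite_image2 +%R fin_i IHr) => _ [n n_le <-].
rewrite big_cons; exists (pi i * (n i)%:R); first by exists (n i) => //=; exact: n_le.
by exists (\sum_(j <- r) pi j * (n j)%:R) => //; exists n.
Qed.

Lemma finite_set_min (A : set R) : finite_set A -> (A !=set0)%classic ->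
  exists2 m, A m & forall y : R, A y -> m <= y.
Proof.
move=> /finite_seqP[s ->] {A}; elim: s => [|a s IHs]; first by case.
move=> _; case: s => [|b s] in IHs *.
  by exists a => [|y]; rewrite /= inE // => /eqP ->.
have [|m ms m_min] := IHs; first by exists b; exact: mem_head.
have [le|lt] := leP a m.
  exists a; first exact: mem_head.
  move=> y /=; rewrite inE => /orP[/eqP->//|ys].
  by rewrite (le_trans le) // m_min.
exists m; first by rewrite /= inE; apply/orP; right.
move=> y /=; rewrite inE => /orP[/eqP->|ys]; first exact: ltW.
exact: m_min.
Qed.

(** There may be infinitely many neighbours of u, but a median function takes
    only finitely many values on them, because their distances to each vertex
    of the support are bounded. *)
Lemma median_fun_min_adj pi u (A : set V) : is_profile pi -> (A !=set0)%classic ->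
    (forall x, A x -> e u x) ->
  exists2 x, A x & forall y, A y -> median_fun e pi x <= median_fun e pi y.
Proof.
move=> pi_prof [x0 Ax0] Au; have [r FE] := median_fun_seq pi_prof.
pose b i := (d i u).+1.
have fin : finite_set [set median_fun e pi x | x in A].
  apply: sub_finite_set (finite_weighted_sums r pi b) => _ [x Ax <-].
  exists (d^~ x); last by rewrite FE.
  by move=> i /=; apply: dist_adj_le; rewrite e_sym; exact: Au.
have [|_ [x Ax <-] x_min] := finite_set_min fin; first by exists (median_fun e pi x0), x0.
by exists x => // y Ay; apply: x_min; exists y.
Qed.

(** Let x minimise F among the neighbours of u on shortest paths to v.  The
    induction hypothesis for x and v gives a neighbour z of x, one step closer
    to v, whose value is at most that of the affine interpolation between F x
    and F v.  A vertex s between u and z with 2 F(s) <= F(u) + F(z) is again a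
    candidate for x, so 2 F(x) <= F(u) + F(z); eliminating F(z) gives the
    claim. *)
Lemma median_fun_convex pi n u v : is_profile pi ->
    (forall u v, d u v = 2 -> exists S, balanced u v S) ->
    d u v = n.+1 ->
  exists x, [/\ e u x, d x v = n &
    n.+1%:R * median_fun e pi x <= n%:R * median_fun e pi u + median_fun e pi v].
Proof.
move=> pi_prof bal; set F := median_fun e pi; elim: n u => [|n IHn] u duv.
  by exists v; rewrite distxx mul0r add0r mul1r; split=> //; exact: adj_dist.
have [x [ux xv] x_min] : exists2 x, e u x /\ d x v = n.+1 &
    forall y, e u y /\ d y v = n.+1 -> F x <= F y.
  apply: (median_fun_min_adj (u := u) (A := [set x | e u x /\ d x v = n.+1])) => //.
    by have [x ux xv] := dist_step duv; exists x.
  by move=> x [].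
exists x; split=> //; have [z [xz zv Fz]] := IHn _ xv.
have duz : d u z = 2.
  have := dist_triangle u z v; have := dist_triangle u x z.
  rewrite (dist_adj ux) (dist_adj xz) zv duv; move: (d u z); clear; lia.
have [S /balanced_median_fun/(_ pi_prof)[s s_int Fs]] := bal _ _ duz.
have [su sz] := (interiorE duz s).1 s_int.
have {}Fs : 2 * F x <= F u + F z.
  apply: le_trans Fs; rewrite ler_pM2l //; apply: x_min; rewrite e_sym; split=> //.
  have := dist_triangle u s v; have := dist_triangle s z v.
  rewrite (dist_sym u s) (dist_adj su) (dist_adj sz) zv duv.
  by move: (d s v); clear; lia.
move: Fs Fz; rewrite -!natr1; have : 0 <= n%:R :> R by exact: ler0n.
move: (F x) (F u) (F v) (F z) (n%:R : R) => fx fu fv fz m; clear.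
nra.
Qed.

(** If u and v are medians, the bound of [median_fun_convex] forces x to be a
    median too. *)
Lemma balanced_connected_medians :
  (forall u v, d u v = 2 -> exists S, balanced u v S) -> connected_medians R e.
Proof.
move=> bal pi pi_prof [u u_med] [v v_med].
have [n duv] : exists n, d u v = n by exists (d u v).
elim: n u u_med duv => [|n IHn] u u_med duv.
  move/dist0: duv => uv; exists 0%N, [::]; split=> //=.
  by apply: val_inj => /=.
have [x [ux xv Fx]] := median_fun_convex pi_prof bal duv.
have x_med : median_set e pi x.
  move=> y; have Fu := set_mem u_med; have Fv := set_mem v_med.
  have := Fu y; have := Fu v; have := Fv u; move: Fx.
  rewrite -natr1; have : 0 <= n%:R :> R by exact: ler0n.
  move: (median_fun _ _ x) (median_fun _ _ y) (median_fun _ _ u) (median_fun _ _ v).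
  move: (n%:R : R) => m fx fy fu fv; clear; nra.
have [k [p [ep lp sp]]] := IHn x (mem_set x_med) xv.
exists k.+1, (exist _ x (mem_set x_med) :: p); split=> //=; last by rewrite sp.
by rewrite ep andbT.
Qed.

End MedianFunctions.

(** * Intervals of length 2 in a partial halved cube *)

Section PartialHalvedCube.
Local Open Scope fset_scope.
Local Open Scope nat_scope.
Hypothesis e_phc : partial_halved_cube e.

(** All vertices of I(u,v) agree outside the four coordinates in which u and v
    differ; hence these four determine their distances to y up to the term
    [c y]. *)
Lemma interval_coordinates u v : d u v = 2 ->
  exists (b : V -> seq bool) (c : V -> nat),
  [/\ forall y, b y \in bitseqs 4, b u = origin, b v = antipode &
      forall y z, d u z + d z v = 2 ->
        2 * d y z = c y + hamming (b y) (b z)].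
Proof.
have [X [f [_ _ f_dist]]] := e_phc; move=> duv.
have dE y z : 2 * d y z = #|` symdiff (val (f y)) (val (f z))|.
  by rewrite -dist_halved_cube f_dist.
pose U := val (f u); pose W := symdiff U (val (f v)).
have sizeW : size W = 4 by have := dE u v; rewrite duv.
pose b y := coordinates U W (val (f y)).
have size_b y : size (b y) = 4 by rewrite size_map.
have bu : b u = origin.
  rewrite /origin -(size_b u); apply/all_pred1P/allP => _ /mapP[i _ ->].
  by rewrite /= addbb.
have bv : b v = antipode.
  rewrite /antipode -(size_b v); apply/all_pred1P/allP => _ /mapP[i + ->].
  by rewrite in_symdiff addbC /= eqb_id.
pose c y := #|` symdiff (val (f y)) U `\` W|.
exists b, c; split=> // [y|y z duz]; first by rewrite -(size_b y) mem_bitseqs.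
have out0 : symdiff (val (f z)) U `\` W = fset0.
  apply/eqP; rewrite -cardfs_eq0.
  have vW : symdiff (val (f z)) (val (f v)) `\` W = symdiff (val (f z)) U `\` W.
    apply/fsetP => i; rewrite !in_fsetD !in_symdiff -/U.
    by case: (i \in val (f z)); case: (i \in U); case: (i \in val (f v)).
  have := dE z u; have := dE z v.
  rewrite !(card_symdiff_hamming U W) vW -/U -!/(b _) bu bv.
  have : hamming (b z) origin + hamming (b z) antipode = 4.
    by apply: hamming_ends; rewrite -(size_b z) mem_bitseqs.
  by rewrite dist_sym in duz; move: (#|` _|) duz; clear; lia.
rewrite dE (card_symdiff_hamming U W) -!/(b _) addnC; congr (_ + _).
rewrite /c; suff -> : symdiff (val (f y)) (val (f z)) `\` W =
  symdiff (val (f y)) U `\` W by [].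
apply/fsetP => i; have /fsetP/(_ i) := out0; rewrite !in_fsetD !in_symdiff inE.
by case: (_ (+) (i \in val (f v))) => //; case: (i \in val (f z)); case: (i \in U).
Qed.

Lemma interior_coordinates u v : d u v = 2 ->
  exists (b : V -> seq bool) (c : V -> nat),
  [/\ forall y, b y \in bitseqs 4,
      forall s, interior e u v s -> b s \in middle,
      forall y, 2 * d y u = c y + hamming (b y) origin /\
                2 * d y v = c y + hamming (b y) antipode,
      forall y s, interior e u v s -> 2 * d y s = c y + hamming (b y) (b s) &
      forall s t, interior e u v s -> interior e u v t ->
        hamming (b s) (b t) = 2 * d s t].
Proof.
move=> duv; have [b [c [b4 bu bv dE]]] := interval_coordinates duv.
have dyu y : 2 * d y u = c y + hamming (b y) origin.
  by rewrite dE ?bu // distxx duv.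
have dyv y : 2 * d y v = c y + hamming (b y) antipode.
  by rewrite dE ?bv // distxx duv.
have dint s : interior e u v s -> d u s + d s v = 2.
  by case=> + _; rewrite /Defs.interval /= duv.
have c0 s : interior e u v s -> c s = 0.
  by move=> /dint/(dE s); rewrite distxx; clear; lia.
exists b, c; split=> // [s s_int|y s /dint/(dE y) //|s t s_int t_int].
  have [su sv] := (interiorE duv s).1 s_int.
  rewrite mem_filter b4 andbT; have := dyu s; have := dyv s.
  by rewrite c0 // !add0n !dist_adj // => <- <-.
by rewrite dE ?c0 //; exact: dint.
Qed.

(** In each of the four coordinates exactly one of u, v is 1, and likewise
    exactly one of the opposite vertices s, t. *)
Lemma interior_opposite u v s t y : d u v = 2 ->
    interior e u v s -> interior e u v t -> d s t = 2 ->
  d y s + d y t = d y u + d y v.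
Proof.
move=> duv s_int t_int dst.
have [b [c [b4 bm dyuv dys bst]]] := interior_coordinates duv.
have := middle_opposite (bm s s_int) (bm t t_int) (b4 y).
rewrite bst // dst => /(_ erefl).
have [] := dyuv y; have := dys y s s_int; have := dys y t t_int.
have := hamming_ends (b4 y).
by clear; lia.
Qed.

Lemma interior_far u v s t y : d u v = 2 ->
    interior e u v s -> interior e u v t -> e s t ->
  2 * d y s = d y u + d y v + 2 -> 2 * d y t = d y u + d y v.
Proof.
move=> duv s_int t_int st.
have [b [c [b4 bm dyuv dys bst]]] := interior_coordinates duv.
have := middle_far (bm s s_int) (bm t t_int) (b4 y).
rewrite bst // (dist_adj st) => /(_ erefl).
have [] := dyuv y; have := dys y s s_int; have := dys y t t_int.
have := hamming_ends (b4 y).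
by clear; lia.
Qed.

(** An octahedron has no clique of size 4. *)
Lemma interior_K4 u v s t w r : d u v = 2 ->
    interior e u v s -> interior e u v t -> interior e u v w ->
    interior e u v r ->
  [&& e s t, e s w, e s r, e t w, e t r & e w r] = false.
Proof.
move=> duv s_int t_int w_int r_int.
have [b [c [_ bm _ _ bst]]] := interior_coordinates duv.
apply/negP => /and5P[st sw sr tw /andP[tr wr]].
have := middle_K4 (bm s s_int) (bm t t_int) (bm w w_int) (bm r r_int).
by rewrite !bst // !dist_adj.
Qed.

(** The rule of signs of [middle_side]: the product of the signs of the three
    excesses is the same for y and z. *)
Lemma interior_side u v s t w y z : d u v = 2 ->
    interior e u v s -> interior e u v t -> interior e u v w ->
    e s t -> e s w -> e t w ->
    (d y u < d y v) = (d z u < d z v) ->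
    [&& d y u + d y v < 2 * d y s, 2 * d y t < d y u + d y v
      & 2 * d y w < d y u + d y v] ->
  d z u + d z v < 2 * d z s -> 2 * d z t < d z u + d z v ->
  2 * d z w < d z u + d z v.
Proof.
move=> duv s_int t_int w_int st sw tw.
have [b [c [b4 bm dyuv dys bst]]] := interior_coordinates duv.
have := middle_side (bm s s_int) (bm t t_int) (bm w w_int) (b4 y) (b4 z).
rewrite (bst s t) // (bst s w) // (bst t w) //.
rewrite (dist_adj st) (dist_adj sw) (dist_adj tw).
move=> /(_ erefl erefl erefl).
have [] := dyuv y; have [] := dyuv z.
have := dys y s s_int; have := dys y t t_int; have := dys y w w_int.
have := dys z s s_int; have := dys z t t_int; have := dys z w w_int.
have := hamming_ends (b4 y); have := hamming_ends (b4 z).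
move: (hamming _ _) (hamming _ _) (hamming _ _) (hamming _ _) (hamming _ _).
move: (hamming _ _) (hamming _ _) (hamming _ _) (hamming _ _) (hamming _ _).
move: (c y) (c z) (d y u) (d y v) (d z u) (d z v) (d y s) (d y t) (d y w).
move: (d z s) (d z t) (d z w); clear; lia.
Qed.

End PartialHalvedCube.

(** * Configurations disconnect medians *)

Section Configurations.
Local Open Scope classical_set_scope.
Local Open Scope nat_scope.
Variables u v : V.
Hypothesis duv : d u v = 2.
Local Notation inner := (interior e u v).
Local Notation ends y := (d y u + d y v).

Lemma inner_adj s : inner s -> [/\ e s u, e s v, d s u = 1 & d s v = 1].
Proof. by move=> /(interiorE duv)[su sv]; rewrite !dist_adj. Qed.

Lemma inner_clique2E s t : interior_clique2 e u v s t <->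
  [/\ inner s, inner t, e s t & forall p, inner p -> p = s \/ p = t].
Proof.
split=> [[I st]|[s_int t_int st I]].
  rewrite I /=; split=> //; tauto.
by split=> //; apply/seteqP; split=> [p /I//|p [->|->]].
Qed.

Lemma inner_clique3E s t w : interior_clique3 e u v s t w <->
  [/\ [/\ inner s, inner t & inner w], [/\ e s t, e s w & e t w] &
      forall p, inner p -> [\/ p = s, p = t | p = w]].
Proof.
split=> [[I adj]|[[s_int t_int w_int] adj I]]; split=> //.
- by rewrite I; split=> /=; tauto.
- by move=> p; rewrite I => -[[->|->]|->]; [exact: Or31|exact: Or32|exact: Or33].
- apply/seteqP; split=> [p /I[]->|p [[->|->]|->]] //=; tauto.
Qed.

Lemma clique3_swap s t w :
  interior_clique3 e u v s t w -> interior_clique3 e u v t s w.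
Proof.
rewrite !inner_clique3E => -[[? ? ?] [? ? ?] I]; split=> //.
  by split=> //; rewrite e_sym.
by move=> p /I[]->; [exact: Or32|exact: Or31|exact: Or33].
Qed.

Lemma clique3_rot s t w :
  interior_clique3 e u v s t w -> interior_clique3 e u v t w s.
Proof.
rewrite !inner_clique3E => -[[? ? ?] [? ? ?] I]; split=> //.
  by split=> //; rewrite e_sym.
by move=> p /I[]->; [exact: Or33|exact: Or31|exact: Or32].
Qed.

(** How the vertices a, b, c of a beta-configuration and the vertex b of an
    alpha-configuration are attached to a common neighbour t of u and v.  The
    sum 3 records that the end not adjacent to b is at distance 2 from it. *)
Definition pendant b t : Prop :=
  [/\ e b t, e b u (+) e b v & ends b = 3].

Lemma pendantE b t : inner t -> e b t -> ~ Defs.interval e u v b ->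
  e b u || e b v -> pendant b t.
Proof.
move=> t_int bt b_out b_end; have [tu tv dtu dtv] := inner_adj t_int.
have b3 : ends b <> 2.
  by rewrite (dist_sym b u) => E; apply: b_out; rewrite /Defs.interval /= duv.
have := dist_triangle b t u; have := dist_triangle b t v.
rewrite (dist_adj bt) dtu dtv => le_v le_u.
have := dist_triangle u b v; rewrite duv (dist_sym u b) => ge2.
have [bu|bu] := boolP (e b u); have [bv|bv] := boolP (e b v).
- by case: b3; rewrite !dist_adj.
- split=> //; first by rewrite bu (negPf bv).
  by move: le_v ge2 b3; rewrite (dist_adj bu); clear; lia.
- split=> //; first by rewrite bv (negPf bu).
  by move: le_u ge2 b3; rewrite (dist_adj bv); clear; lia.
- by rewrite (negPf bu) (negPf bv) in b_end.
Qed.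

Lemma pendant_notin b t : pendant b t -> ~ Defs.interval e u v b.
Proof.
by move=> [_ _ b3]; rewrite /Defs.interval /= duv dist_sym b3.
Qed.

Lemma pendant_or b t : pendant b t -> e b u || e b v.
Proof. by move=> [_ + _]; case: (e b u) => // /=. Qed.

Lemma pendant_inner b t s : pendant b t -> inner s -> b <> s.
Proof.
move=> [_ _ b3] /inner_adj[_ _ su sv] E; move: b3; rewrite E su sv; discriminate.
Qed.

Lemma pendant_ge2 b t s : pendant b t -> inner s -> ~~ e b s -> 2 <= d b s.
Proof. by move=> bP s_int; apply: dist_ge2; exact: pendant_inner bP s_int. Qed.

(** The distance sums of the multisets {a, b}, {a1, a2, b}, {a1, a2, a3} of the
    three types add up to 7, 11, 12 over u and v, and are at least 4, 6, 7 at
    every common neighbour. *)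
Lemma connected_medians_no_alpha (R : realType) :
  connected_medians R e -> ~ in_alpha_configuration e u v.
Proof.
move=> e_med; have dom L := connected_medians_interior L e_med duv.
case=> [[]||].
- move=> [s [t [/inner_clique2E[s_int t_int st I]
    [a [b [[au av as_ at_] b_out /and3P[bt bs b_end]]]]]]].
  have bP := pendantE t_int bt b_out b_end.
  have [p /I] := dom [:: a; b]; have [_ _ b3] := bP.
  have := pendant_ge2 bP s_int bs; have := dist_adj bt.
  rewrite !big_cons !big_nil => bt1 bs2.
  by case=> ->; move: au av as_ at_ b3 bt1 bs2; clear; lia.
- move=> [s [t [w [/inner_clique3E[[s_int t_int w_int] _ I]
    [a [b [[au av as_ aw at_] b_out /and4P[bt bs bw b_end]]]]]]]].
  have bP := pendantE t_int bt b_out b_end.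
  have [p /I] := dom [:: a; b]; have [_ _ b3] := bP.
  have := pendant_ge2 bP s_int bs; have := pendant_ge2 bP w_int bw.
  have := dist_adj bt.
  rewrite !big_cons !big_nil => bt1 bw2 bs2.
  by case=> ->; move: au av as_ aw at_ b3 bt1 bw2 bs2; clear; lia.
- move=> [s [t [w [/inner_clique3E[[s_int t_int w_int] _ I]
    [a [a' [b [[au av as_ aw at_] [a'u a'v a's a't a'w] b_out /and4P[bt bw bs b_end]]]]]]]]].
  have bP := pendantE t_int bt b_out b_end.
  have [p /I] := dom [:: a; a'; b]; have [_ _ b3] := bP.
  have := pendant_ge2 bP s_int bs; have := dist_adj bt; have := dist_adj bw.
  rewrite !big_cons !big_nil => bw1 bt1 bs2.
  case=> ->; move: au av as_ aw at_ a'u a'v a's a't a'w b3 bw1 bt1 bs2; clear; lia.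
- move=> [s [t [w [/inner_clique3E[_ _ I]
    [a [a' [a'' [[au av as_ aw at_] [a'u a'v a's a't a'w]
      [a''u a''v a''t a''w a''s]]]]]]]]].
  have [p /I] := dom [:: a; a'; a''].
  rewrite !big_cons !big_nil => -[]->.
  - by rewrite au av as_ a'u a'v a's a''u a''v a''s.
  - by rewrite au av at_ a'u a'v a't a''u a''v a''t.
  - by rewrite au av aw a'u a'v a'w a''u a''v a''w.
Qed.

(** The distance sums of {a, b, c} add up to 9 over u and v, and are at least
    5 at every common neighbour. *)
Lemma connected_medians_no_beta (R : realType) :
  connected_medians R e -> ~ in_beta_configuration e u v.
Proof.
move=> e_med [s [t [w [a [b [c [/inner_clique3E[[s_int t_int w_int] _ I]
  uniq8 /and4P[as_ a_end at_ aw] /and4P[bt b_end bs bw]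
  /and4P[cw c_end cs ct]]]]]]]].
have pend x r : inner r -> e x r -> e x u (+) e x v -> pendant x r.
  move=> r_int xr x_end; split=> //; have [ru rv dru drv] := inner_adj r_int.
  have := dist_triangle x r u; have := dist_triangle x r v.
  rewrite (dist_adj xr) dru drv => le_v le_u.
  have x_u : ~~ e x u -> d x u <> 1 by move=> xu /adj_dist; exact/negP.
  have x_v : ~~ e x v -> d x v <> 1 by move=> xv /adj_dist; exact/negP.
  have nu : d x u <> 0.
    move/dist0 => E; move: x_end; rewrite E e_irr /= => /dist_adj.
    by rewrite duv.
  have nv : d x v <> 0.
    move/dist0 => E; move: x_end; rewrite E e_irr addbF e_sym => /dist_adj.
    by rewrite duv.
  move: x_end; have [/dist_adj xu|/x_u xu] := boolP (e x u) => /=.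
    by move=> /x_v; move: xu le_v nv; clear; lia.
  by move=> /dist_adj; move: xu le_u nu; clear; lia.
have aP := pend _ _ s_int as_ a_end; have bP := pend _ _ t_int bt b_end.
have cP := pend _ _ w_int cw c_end.
have [p /I] := connected_medians_interior [:: a; b; c] e_med duv.
have [_ _ a3] := aP; have [_ _ b3] := bP; have [_ _ c3] := cP.
have dat := pendant_ge2 aP t_int at_; have daw := pendant_ge2 aP w_int aw.
have dbs := pendant_ge2 bP s_int bs; have dbw := pendant_ge2 bP w_int bw.
have dcs := pendant_ge2 cP s_int cs; have dct := pendant_ge2 cP t_int ct.
rewrite !big_cons !big_nil a3 b3 c3 => -[]->.
- by rewrite (dist_adj as_); move: dbs dcs; clear; lia.
- by rewrite (dist_adj bt); move: dat dct; clear; lia.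
- by rewrite (dist_adj cw); move: daw dbw; clear; lia.
Qed.

(** * From excesses to configurations *)

Hypothesis e_mesh : meshed e.
Hypothesis e_phc : partial_halved_cube e.

(** The excess of y at s is 2, its largest possible value. *)
Definition far s : Prop := exists y, 2 * d y s = ends y + 2.

(** [low_only] and [high_only] prescribe the signs of the three excesses of some
    vertex y. *)
Definition low_only s t w : Prop := exists y,
  [/\ 2 * d y s < ends y, ends y < 2 * d y t & ends y < 2 * d y w].

Definition high_only s t w : Prop := exists y,
  [/\ ends y < 2 * d y s, 2 * d y t < ends y & 2 * d y w < ends y].

Lemma inner_le y s : inner s -> [/\ d y s <= (d y u).+1, d y s <= (d y v).+1,
  d y u <= (d y s).+1 & d y v <= (d y s).+1].
Proof.
by move=> /inner_adj[su sv _ _]; split; apply: dist_adj_le => //; rewrite e_sym.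
Qed.

Lemma adj_le y s t : e s t -> d y s <= (d y t).+1 /\ d y t <= (d y s).+1.
Proof. by move=> st; split; apply: dist_adj_le => //; rewrite e_sym. Qed.

Lemma meshed_inner y : exists2 s, inner s & 2 * d y s <= ends y.
Proof.
by have [s [su sv le]] := e_mesh y duv; exists s => //; apply/(interiorE duv).
Qed.

(** Where y has excess 2 at t it has excess 0 at the other vertices of the
    clique, which is what [far_vertex] requires; for the same reason the new
    vertex a has distance 2 to all of them. *)
Lemma far_vertex_inner s t : inner s -> inner t -> e t s ->
    (forall p, inner p -> p = t \/ e t p) -> far t ->
  exists a, [/\ d a u = 2, d a v = 2, d a t = 3 &
    forall p, inner p -> e t p -> d a p = 2].
Proof.
move=> s_int t_int ts t_adj [x xt]; have [le1 le2 _ _] := inner_le x t_int.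
have xu : d x u = d x v by move: xt le1 le2; clear; lia.
have xp p : inner p -> e t p -> d x p = d x v.
  move=> p_int tp; have := interior_far e_phc duv t_int p_int tp xt.
  by move: xu; clear; lia.
have [||a [au av as_ at_]] := far_vertex e_mesh duv s_int t_int xu erefl (xp s s_int ts).
- by move: xt xu; clear; lia.
- move=> p p_int; have [->|tp] := t_adj p p_int; last by rewrite xp.
  by move: xt xu; clear; lia.
exists a; split=> // p p_int tp.
have := interior_far e_phc duv t_int p_int tp (y := a).
by rewrite au av at_ => /(_ erefl); clear; lia.
Qed.

(** As s and t are adjacent, the excesses of y are -1 at t and 1 at s.  So y is
    nearer to one of u, v than to the other, and equally far from this one and
    from t; the triangle condition for these two gives b.  The comparison of
    distances to u and v makes the rule of signs applicable to b. *)
Lemma pendant_exists y s t : inner s -> inner t -> e s t ->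
    2 * d y t < ends y -> ends y < 2 * d y s ->
  exists b, [/\ pendant b t, (d b u < d b v) = (d y u < d y v) &
    forall p, inner p -> ends y < 2 * d y p -> ~~ e b p].
Proof.
move=> s_int t_int st lo hi; have [le1 le2 _ _] := inner_le y s_int.
have [tu tv dtu dtv] := inner_adj t_int.
have [le3 _] := adj_le y st.
have [_ _ le4 le5] := inner_le y t_int.
have near p q k : e p t -> d t q = 1 -> d y p = k -> d y t = k -> d y q = k.+1 ->
    d p q = 2 ->
  exists b, [/\ e b t, e b p, d b q = 2 & forall z, k < d y z -> ~~ e b z].
  move=> pt tq yp yt yq dpq; case: k => [|k] in yp yt yq *.
    by move: pt; rewrite -(dist0 yp) -(dist0 yt) e_irr.
  have [b [bp bt b_far]] := near_vertex e_mesh pt yp yt.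
  exists b; split=> //; apply/eqP; rewrite eqn_leq.
  have := dist_triangle b t q; rewrite (dist_adj bt) tq => -> /=.
  apply: dist_ge2; last by rewrite b_far ?yq.
  by move=> E; move: dpq; rewrite -E dist_sym (dist_adj bp).
have [[yu yv]|[yu yv]] : (d y u = d y t /\ d y v = (d y t).+1) \/
    (d y v = d y t /\ d y u = (d y t).+1).
  by move: lo hi le1 le2 le3 le4 le5; clear; lia.
- have ut : e u t by rewrite e_sym.
  have [b [bt bu bv b_far]] := near _ _ _ ut dtv yu erefl yv duv.
  exists b; split.
  + split=> //; last by rewrite (dist_adj bu) bv.
    by rewrite bu /=; apply/negP => /dist_adj; rewrite bv.
  + by rewrite (dist_adj bu) bv yu yv !ltnSn.
  + by move=> p _ p_hi; apply: b_far; move: p_hi; rewrite yu yv; clear; lia.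
- have vt : e v t by rewrite e_sym.
  have dvu : d v u = 2 by rewrite dist_sym.
  have [b [bt bv bu b_far]] := near _ _ _ vt dtu yu erefl yv dvu.
  exists b; split.
  + split=> //; last by rewrite (dist_adj bv) bu.
    by rewrite bv addbT; apply/negP => /dist_adj; rewrite bu.
  + by rewrite (dist_adj bv) bu yu yv; clear; lia.
  + by move=> p _ p_hi; apply: b_far; move: p_hi; rewrite yu yv; clear; lia.
Qed.

(** * Two adjacent common neighbours *)

Lemma far_alpha2 s t b : interior_clique2 e u v s t -> far t ->
  pendant b t -> ~~ e b s -> alpha_type1 e u v.
Proof.
move=> C t_far bP bs; left; exists s, t; split=> //.
have [s_int t_int st I] := (inner_clique2E s t).1 C.
have ts : e t s by rewrite e_sym.
have [|a [au av at_ a_near]] := far_vertex_inner s_int t_int ts _ t_far.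
  by move=> p /I[]->; [right|left].
exists a, b; split; first by split=> //; exact: a_near.
  exact: pendant_notin bP.
by rewrite bs (pendant_or bP); case: bP => ->.
Qed.

(** A vertex y with positive excess at s yields the vertex b of type 1: through
    [pendant_exists] if the excess is 1, and through the triangle condition for
    u and t if it is 2, since then y is equally far from u, v and t. *)
Lemma balanced_far2 s t : interior_clique2 e u v s t -> far t ->
  ~ in_alpha_configuration e u v -> balanced u v [:: s].
Proof.
move=> C t_far no_alpha; have [s_int t_int st I] := (inner_clique2E s t).1 C.
split=> // [p|y]; first by rewrite inE => /eqP->.
rewrite big_seq1 mul1n leqNgt; apply/negP => hi; apply/no_alpha/Or31.
have [lo|/(conj hi) nlo] := boolP (2 * d y t < ends y).
  have [b [bP _ b_far]] := pendant_exists s_int t_int st lo hi.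
  exact: far_alpha2 C t_far bP (b_far _ s_int hi).
have [p /I[]-> le] := meshed_inner y; first by rewrite leqNgt hi in le.
have yt : 2 * d y t = ends y by move: nlo le; clear; lia.
have [le1 le2 _ _] := inner_le y s_int.
have [le3 le4 le5 le6] := inner_le y t_int; have [le7 _] := adj_le y st.
have [yu yv ys] : [/\ d y u = d y t, d y v = d y t & d y s = (d y t).+1].
  by split; move: hi yt le1 le2 le3 le4 le5 le6 le7; clear; lia.
have [tu tv dtu dtv] := inner_adj t_int; have ut : e u t by rewrite e_sym.
move: yu yv ys; case yt' : (d y t) => [|k] yu yv ys.
  by move: duv; rewrite -(dist0 yu) -(dist0 yv) distxx.
have [b [bu bt yb]] := triangle_condition e_mesh ut yu yt'.
have bs : ~~ e b s.
  by apply/negP => bs; have [] := adj_le y bs; move: yb ys; clear; lia.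
have bv : ~~ e b v.
  apply/negP => bv; have /I[] : inner b by apply/(interiorE duv).
    by move=> E; move: yb; rewrite E ys; clear; lia.
  by move=> E; move: yb; rewrite E yt'; clear; lia.
apply: far_alpha2 C t_far _ bs; apply: pendantE => //; last by rewrite bu.
move=> b_int; have : d b v = 1.
  by move: b_int; rewrite /Defs.interval /= duv dist_sym (dist_adj bu); clear; lia.
by move/adj_dist; exact/negP.
Qed.

Lemma clique2_swap s t : interior_clique2 e u v s t -> interior_clique2 e u v t s.
Proof.
rewrite !inner_clique2E => -[? ? ? I]; split=> //; first by rewrite e_sym.
by move=> p /I[]->; [right|left].
Qed.

Lemma balanced_clique2 s t : interior_clique2 e u v s t ->
  ~ in_alpha_configuration e u v -> exists S, balanced u v S.
Proof.
move=> C no_alpha; have C' := clique2_swap C.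
have [t_far|t_near] := pselect (far t).
  by exists [:: s]; exact: balanced_far2 C t_far no_alpha.
have [s_far|s_near] := pselect (far s).
  by exists [:: t]; exact: balanced_far2 C' s_far no_alpha.
have [s_int t_int st I] := (inner_clique2E s t).1 C.
exists [:: s; t]; split=> // [p|y].
  by rewrite !inE => /orP[]/eqP->.
rewrite big_cons big_seq1 /=.
have ys : 2 * d y s <> ends y + 2 by move=> E; apply: s_near; exists y.
have yt : 2 * d y t <> ends y + 2 by move=> E; apply: t_near; exists y.
have [le1 le2] := adj_le y st.
have [p /I[]-> le] := meshed_inner y; move: ys yt le1 le2 le; clear; lia.
Qed.

(** * Three pairwise adjacent common neighbours *)

Lemma far_clique3 s t w : interior_clique3 e u v s t w -> far t ->
  exists a, [/\ d a u = 2, d a v = 2, d a s = 2, d a w = 2 & d a t = 3].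
Proof.
move=> C t_far.
have [[s_int t_int w_int] [st sw tw] I] := (inner_clique3E s t w).1 C.
have ts : e t s by rewrite e_sym.
have [|a [au av at_ a_near]] := far_vertex_inner s_int t_int ts _ t_far.
  by move=> p /I[]->; [right|left|right].
by exists a; split=> //; exact: a_near.
Qed.

Lemma low_only_pendant s t w : interior_clique3 e u v s t w -> low_only s t w ->
  exists b, [/\ pendant b s, ~~ e b t & ~~ e b w].
Proof.
move=> C [y [lo hit hiw]].
have [[s_int t_int w_int] [st _ _] _] := (inner_clique3E s t w).1 C.
have ts : e t s by rewrite e_sym.
have [b [bP _ b_far]] := pendant_exists t_int s_int ts lo hit.
by exists b; split=> //; exact: b_far.
Qed.

Lemma clique3_alpha1 s t w : interior_clique3 e u v s t w ->
  far t -> low_only t s w -> in_alpha_configuration e u v.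
Proof.
move=> C t_far /(low_only_pendant (clique3_swap C))[b [bP bs bw]].
have [a a_dist] := far_clique3 C t_far.
apply: Or31; right; exists s, t, w; split=> //; exists a, b; split=> //.
  exact: pendant_notin bP.
by rewrite bs bw (pendant_or bP); case: bP => ->.
Qed.

(** The neighbour b of t obtained from y lies on the same side of I(u,v) as y,
    so the rule of signs shows that, like y, it has excess -1 at w, that is,
    b is adjacent to w. *)
Lemma clique3_alpha2 s t w : interior_clique3 e u v s t w ->
  far t -> far w -> high_only s t w -> in_alpha_configuration e u v.
Proof.
move=> C t_far w_far [y [hi lot low]].
have [[s_int t_int w_int] [st sw tw] I] := (inner_clique3E s t w).1 C.
have [b [bP b_side b_far]] := pendant_exists s_int t_int st lot hi.
have bs := b_far s s_int hi.
have [a1 a1_dist] := far_clique3 C t_far.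
have Csw : interior_clique3 e u v s w t by exact/clique3_swap/clique3_rot/clique3_rot.
have [a2 a2_dist] := far_clique3 Csw w_far.
apply: Or32; exists s, t, w; split=> //; exists a1, a2, b; split=> //.
  exact: pendant_notin bP.
rewrite bs (pendant_or bP); have [bt _ b3] := bP; rewrite bt /=.
have /= := interior_side e_phc duv s_int t_int w_int st sw tw (esym b_side).
rewrite hi lot low b3 (dist_adj bt) => /(_ isT).
have := pendant_ge2 bP s_int bs; have := dist_pos (pendant_inner bP w_int).
move=> bw_pos bs2 H; rewrite andbT; apply: adj_dist.
by move: H bs2 bw_pos; clear; lia.
Qed.

Lemma clique3_alpha3 s t w : interior_clique3 e u v s t w ->
  far s -> far t -> far w -> in_alpha_configuration e u v.
Proof.
move=> C s_far t_far w_far.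
have [a1 a1_dist] := far_clique3 C t_far.
have [a2 [? ? ? ? ?]] := far_clique3 (clique3_rot C) w_far.
have [a3 [? ? ? ? ?]] := far_clique3 (clique3_rot (clique3_rot C)) s_far.
by apply: Or33; exists s, t, w; split=> //; exists a1, a2, a3.
Qed.

Lemma clique3_beta s t w : interior_clique3 e u v s t w ->
  low_only s t w -> low_only t w s -> low_only w s t -> in_beta_configuration e u v.
Proof.
move=> C Ps Pt Pw.
have [a [aP at_ aw]] := low_only_pendant C Ps.
have [b [bP bw bs]] := low_only_pendant (clique3_rot C) Pt.
have [c [cP cs ct]] := low_only_pendant (clique3_rot (clique3_rot C)) Pw.
have [[s_int t_int w_int] [st sw tw] I] := (inner_clique3E s t w).1 C.
have [as_ a_end _] := aP; have [bt b_end _] := bP; have [cw c_end _] := cP.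
exists s, t, w, a, b, c; split=> //; try by apply/and4P.
have neq x y z : e x y -> ~~ e z y -> x != z.
  by move=> xy; apply: contraNneq => <-.
have ends_neq p r : pendant p r -> u != p /\ v != p.
  move=> [_ _ p3]; split; apply/eqP => E; move: p3;
    by rewrite -E ?distxx ?(dist_sym v u) duv.
have [su sv _ _] := inner_adj s_int; have [tu tv _ _] := inner_adj t_int.
have [wu wv _ _] := inner_adj w_int.
have adj_neq x y : e x y -> x != y by apply: contraTneq => ->; rewrite e_irr.
have int_neq p r x : pendant p r -> inner x -> x != p.
  by move=> pP x_int; rewrite eq_sym; apply/eqP; exact: pendant_inner pP x_int.
have uv : u != v by apply/eqP => E; move: duv; rewrite E distxx.
have [ua va] := ends_neq _ _ aP; have [ub vb] := ends_neq _ _ bP.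
have [uc vc] := ends_neq _ _ cP.
have := (int_neq _ _ s aP s_int, int_neq _ _ t aP t_int, int_neq _ _ w aP w_int).
have := (int_neq _ _ s bP s_int, int_neq _ _ t bP t_int, int_neq _ _ w bP w_int).
have := (int_neq _ _ s cP s_int, int_neq _ _ t cP t_int, int_neq _ _ w cP w_int).
move=> [[sc tc] wc] [[sb tb] wb] [[sa ta] wa].
rewrite /= !inE !negb_or (neq a s b) // (neq a s c) // (neq b t c) // uv ua va.
rewrite ub vb uc vc sc tc wc sb tb wb sa ta wa.
rewrite !(eq_sym u) !(eq_sym v) !(adj_neq _ u) // !(adj_neq _ v) //.
by rewrite !adj_neq.
Qed.

(** A vertex y with positive excess at s gives a configuration: of type 3 if the
    excess is 2, and otherwise, as one of the excesses at t and w is -1 by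
    meshedness, of type 1 or 2. *)
Lemma balanced_clique3_far2 s t w : interior_clique3 e u v s t w ->
    far t -> far w -> ~ in_alpha_configuration e u v ->
  balanced u v [:: s].
Proof.
move=> C t_far w_far no_alpha.
have Csw : interior_clique3 e u v s w t by exact/clique3_swap/clique3_rot/clique3_rot.
have [[s_int t_int w_int] [st sw tw] I] := (inner_clique3E s t w).1 C.
split=> // [p|y]; first by rewrite inE => /eqP->.
rewrite big_seq1 mul1n leqNgt; apply/negP => hi; apply: no_alpha.
have [ys|ys] := eqVneq (2 * d y s) (ends y + 2).
  by apply: clique3_alpha3 C _ t_far w_far; exists y.
have [le1 le2] := adj_le y st; have [le3 le4] := adj_le y sw.
have [lot|hit] := ltnP (2 * d y t) (ends y).
  have [low|hiw] := ltnP (2 * d y w) (ends y).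
    by apply: clique3_alpha2 C t_far w_far _; exists y.
  apply: clique3_alpha1 C t_far _; exists y; split=> //.
  by move: hi ys le3 le4 hiw; clear; lia.
apply: clique3_alpha1 Csw w_far _; exists y.
have [p /I[]-> le] := meshed_inner y.
- by rewrite leqNgt hi in le.
- by move: hi ys le1 le2 hit le; clear; lia.
- by split=> //; move: hi ys le1 le2 le3 le4 hit le; clear; lia.
Qed.

(** The excesses at s and w are at most 1, so their sum is positive only if both
    are 1; then the excess at t is -1 by meshedness. *)
Lemma balanced_clique3_pair s t w : interior_clique3 e u v s t w ->
    ~ far s -> ~ far w -> ~ low_only t s w ->
  balanced u v [:: s; w].
Proof.
move=> C s_near w_near no_low.
have [[s_int t_int w_int] [st sw tw] I] := (inner_clique3E s t w).1 C.
split=> // [p|y]; first by rewrite !inE => /orP[]/eqP->.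
rewrite big_cons big_seq1 /=.
have ys : 2 * d y s <> ends y + 2 by move=> E; apply: s_near; exists y.
have yw : 2 * d y w <> ends y + 2 by move=> E; apply: w_near; exists y.
have [le1 le2] := adj_le y st; have [le3 le4] := adj_le y sw.
have [le5 le6] := adj_le y tw.
have {}no_low : ~~ [&& 2 * d y t < ends y, ends y < 2 * d y s & ends y < 2 * d y w].
  by apply/negP => /and3P low; apply: no_low; exists y.
have : [|| 2 * d y s <= ends y, 2 * d y t <= ends y | 2 * d y w <= ends y].
  by have [p /I[]-> ->] := meshed_inner y; rewrite ?orbT.
move: no_low ys yw le1 le2 le3 le4 le5 le6.
move: (d y s) (d y t) (d y w) (d y u + d y v); clear; lia.
Qed.

(** The cases are those of how many of s, t, w are far. *)
Lemma balanced_clique3 s t w : interior_clique3 e u v s t w ->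
    ~ (in_alpha_configuration e u v \/ in_beta_configuration e u v) ->
  exists S, balanced u v S.
Proof.
move=> C /not_orP[no_alpha no_beta].
have Ct := clique3_rot C; have Cw := clique3_rot Ct.
have Ct' := clique3_swap C.
have pair x y z : interior_clique3 e u v x y z -> far y ->
    ~ far x -> ~ far z -> exists S, balanced u v S.
  move=> Cx y_far x_near z_near; exists [:: x; z].
  apply: (balanced_clique3_pair Cx x_near z_near) => low.
  exact/no_alpha/(clique3_alpha1 Cx y_far low).
have single x y z : interior_clique3 e u v x y z ->
    far y -> far z -> exists S, balanced u v S.
  move=> Cx y_far z_far; exists [:: x].
  exact: balanced_clique3_far2 Cx y_far z_far no_alpha.
have [s_far|s_near] := pselect (far s); have [t_far|t_near] := pselect (far t);
  have [w_far|w_near] := pselect (far w).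
- by case: no_alpha; exact: clique3_alpha3 C s_far t_far w_far.
- exact: single Cw s_far t_far.
- exact: single Ct w_far s_far.
- exact: pair Ct' s_far t_near w_near.
- exact: single C t_far w_far.
- exact: pair C t_far s_near w_near.
- exact: pair Ct w_far t_near s_near.
have [s_low|s_nlow] := pselect (low_only s t w); last first.
  by exists [:: t; w]; exact: balanced_clique3_pair Ct' t_near w_near s_nlow.
have [t_low|t_nlow] := pselect (low_only t s w); last first.
  by exists [:: s; w]; exact: balanced_clique3_pair C s_near w_near t_nlow.
have [w_low|w_nlow] := pselect (low_only w t s); last first.
  by exists [:: t; s]; exact: balanced_clique3_pair Ct t_near s_near w_nlow.
case: no_beta; apply: clique3_beta C s_low _ _.
  by have [y [? ? ?]] := t_low; exists y.
by have [y [? ? ?]] := w_low; exists y.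
Qed.

Lemma exists_balanced :
    (interior_clique23 e u v ->
      ~ (in_alpha_configuration e u v \/ in_beta_configuration e u v)) ->
  exists S, balanced u v S.
Proof.
move=> no_config.
have [[s [t [s_int t_int dst]]]|clique] :=
    pselect (exists s t, [/\ inner s, inner t & d s t = 2]).
  exists [:: s; t]; split=> // [p|y]; first by rewrite !inE => /orP[]/eqP->.
  by rewrite big_cons big_seq1 (interior_opposite e_phc y duv s_int t_int dst).
have {}clique p q : inner p -> inner q -> p <> q -> e p q.
  move=> p_int q_int pq; apply: contrapT => /negP pNq; apply: clique.
  exists p, q; split=> //; apply/eqP; rewrite eqn_leq dist_ge2 // andbT.
  have [pu _ dpu _] := inner_adj p_int; have [qu _ dqu _] := inner_adj q_int.
  by have := dist_triangle p u q; rewrite dpu (dist_sym u q) dqu.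
have [s s_int _] := meshed_inner u.
have [I1|] := pselect (forall p, inner p -> p = s).
  exists [:: s]; split=> // [p|y]; first by rewrite inE => /eqP->.
  by rewrite big_seq1 mul1n; have [p /I1-> ->] := meshed_inner y.
move=> /existsNP[t /not_implyP[t_int /nesym ts]]; have st := clique _ _ s_int t_int ts.
have [I2|] := pselect (forall p, inner p -> p = s \/ p = t).
  have C : interior_clique2 e u v s t by apply/inner_clique2E.
  apply: (balanced_clique2 C) => alpha.
  by apply: no_config; [left; exists s, t|left].
move=> /existsNP[w /not_implyP[w_int /not_orP[/nesym ws /nesym wt]]].
have sw := clique _ _ s_int w_int ws; have tw := clique _ _ t_int w_int wt.
have C : interior_clique3 e u v s t w.
  apply/inner_clique3E; split=> // p p_int; apply: contrapT => none.
  have ps : s <> p by move=> E; apply: none; rewrite -E; exact: Or31.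
  have pt : t <> p by move=> E; apply: none; rewrite -E; exact: Or32.
  have pw : w <> p by move=> E; apply: none; rewrite -E; exact: Or33.
  have := interior_K4 e_phc duv s_int t_int w_int p_int; rewrite st sw tw /=.
  by rewrite !clique.
by apply: (balanced_clique3 C); apply: no_config; right; exists s, t, w.
Qed.

End Configurations.

End Distance.

Theorem theorem68 (R : realType) (V : choiceType) (e : rel V)
    (e_sym : symmetric e) (e_irr : irreflexive e)
    (e_conn : connected_graph e) (e_phc : partial_halved_cube e) :
  connected_medians R e <->
  (meshed e /\
   forall u v : V, dist e u v = 2 -> interior_clique23 e u v ->
     ~ (in_alpha_configuration e u v \/ in_beta_configuration e u v)).
Proof.
split=> [e_med|[e_mesh no_config]]; last first.
  apply: balanced_connected_medians => // u v duv.
  by apply: exists_balanced => //; exact: no_config.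
split=> [u v w dvw|u v duv _].
  have [x] := connected_medians_interior e_sym e_irr e_conn [:: u] e_med dvw.
  rewrite !big_seq1 => /(interiorE e_sym e_irr e_conn dvw)[xv xw] le.
  by exists x.
by case=> [/(connected_medians_no_alpha e_sym e_irr e_conn duv e_med)
          |/(connected_medians_no_beta e_sym e_irr e_conn duv e_med)].
Qed.
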